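(* Let $p$ be a prime, and let $1\to K\xrightarrow{\iota} G\to Q\to 1$ be a $p$-exact sequence of groups, with $Q$ an elementary abelian $p$-group. Then: (1) The map $\iota$ induces a $\mathbb{Z}_p[K_{\mathrm{ab}}\otimes\mathbb{Z}_p]$-linear isomorphism $B_p(K)\to B_p(G)$ (where $B_p(G)$ is regarded as a $\mathbb{Z}_p[K_{\mathrm{ab}}\otimes\mathbb{Z}_p]$-module by restriction of scalars along the ring map induced by $\iota$). (2) If $b_1^p(G)<\infty$, then $\theta^p_n(K)\le\theta^p_n(G)$ for all $n\ge 1$. (3) If the sequence is split exact, then $\iota$ induces isomorphisms of graded Lie algebras $\mathrm{gr}^p_{\ge2}(K)\xrightarrow{\simeq}\mathrm{gr}^p_{\ge2}(G)$ and $\mathrm{gr}^p_{\ge2}(K/K''_p)\xrightarrow{\simeq}\mathrm{gr}^p_{\ge2}(G/G''_p)$. Moreover, if $b_1^p(G)<\infty$, then $\phi^p_n(K)=\phi^p_n(G)$ and $\theta^p_n(K)=\theta^p_n(G)$ for all $n\ge2$.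
   Context: $\mathbb{Z}_p=\mathbb{Z}/p\mathbb{Z}$. For a group $G$ and subgroup $H$, $H^p$ is the subgroup generated by $p$-th powers of elements of $H$. $G_{\mathrm{ab}}=G/[G,G]$, and $G_{\mathrm{ab}}\otimes\mathbb{Z}_p=H_1(G;\mathbb{Z}_p)$. A short exact sequence $1\to K\to G\to Q\to1$ is $p$-exact if the induced sequence $0\to H_1(K;\mathbb{Z}_p)\to H_1(G;\mathbb{Z}_p)\to H_1(Q;\mathbb{Z}_p)\to0$ is exact. $G'_p=\langle G^p,[G,G]\rangle$, $G''_p=\langle (G'_p)^p,[G'_p,G'_p]\rangle$; $G/G'_p=H_1(G;\mathbb{Z}_p)$. The mod-$p$ Alexander invariant is $B_p(G)=G'_p/G''_p$, a $\mathbb{Z}_p[H_1(G;\mathbb{Z}_p)]$-module via conjugation; it is functorial in $G$. Mod-$p$ lower central series: $\gamma^p_1(G)=G$, $\gamma^p_{n+1}(G)=\langle(\gamma^p_n(G))^p,[G,\gamma^p_n(G)]\rangle$; $\mathrm{gr}^p(G)=\bigoplus_{n\ge1}\gamma^p_n(G)/\gamma^p_{n+1}(G)$, a graded Lie algebra over $\mathbb{Z}_p$ with bracket induced by the group commutator; $\mathrm{gr}^p_{\ge2}$ is its part in degrees $\ge2$. $b_1^p(G)=\dim_{\mathbb{Z}_p}H_1(G;\mathbb{Z}_p)$; when this is finite, $\phi^p_n(G)=\dim_{\mathbb{Z}_p}\mathrm{gr}^p_n(G)$ and $\theta^p_n(G)=\dim_{\mathbb{Z}_p}\mathrm{gr}^p_n(G/G''_p)$.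 *)

(* Defs.v *)
From HB Require Import structures.
From mathcomp Require Import finmap.
From mathcomp.multinomials Require Import monalg.
From mathcomp Require Import all_boot all_algebra.
From mathcomp Require Import boolp classical_sets.

Set Implicit Arguments.
Unset Strict Implicit.
Unset Printing Implicit Defensive.

Import GRing.Theory.

(* Groups are MathComp [groupType]s, not assumed finite; the decidable equality
   and the choice operator they carry are harmless in classical logic. *)

Section Subgroups.
Local Open Scope group_scope.
Variable G : groupType.
Implicit Types (A : set G) (H K S : {pred G}) (x y z : G).

Definition gen A : {pred G} := fun x =>
  `[< forall S, group_closed S -> (forall y, A y -> y \in S) -> x \in S >].

Definition join H K := gen [set x | x \in H \/ x \in K].
Definition powers p H := gen [set z | exists2 x, x \in H & z = x ^+ p].
Definition commutators H K :=
  gen [set z | exists x y, [/\ x \in H, y \in K & z = [~ x, y]]].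

(* <H^p, [H, H]>: G'_p is [pderived p predT], G''_p is [pderived2 p G]. *)
Definition pderived p H := join (powers p H) (commutators H H).
Definition pderived1 p : {pred G} := pderived p predT.
Definition pderived2 p : {pred G} := pderived p (pderived1 p).

(* [lcs p n] is gamma^p_n(G); the index 0, which is not used in the theory,
   gives G, so that the degree 0 part of the graded Lie algebra is zero. *)
Definition lcs p n : {pred G} :=
  iter n.-1 (fun H => join (powers p H) (commutators predT H)) predT.

Lemma genP A x : reflect
  (forall S, group_closed S -> (forall y, A y -> y \in S) -> x \in S)
  (x \in gen A).
Proof. exact: asboolP. Qed.

Lemma mem_gen A x : A x -> x \in gen A.
Proof. by move=> Ax; apply/genP => S _; apply. Qed.

Lemma gen_group A : group_closed (gen A).
Proof.
split; first by apply/genP => S [].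
move=> x y /genP Hx /genP Hy; apply/genP => S gS AS.
by case: (gS) => _; apply; [apply: Hx | apply: Hy].
Qed.

Lemma predT_group : group_closed (predT : {pred G}).
Proof. by []. Qed.

Lemma lcsS p n : lcs p n.+2 =
  join (powers p (lcs p n.+1)) (commutators predT (lcs p n.+1)).
Proof. by []. Qed.

Lemma lcs_group p n : group_closed (lcs p n).
Proof. by case: n => [|[|n]]; [exact: predT_group.. | exact: gen_group]. Qed.

Lemma mem_powers p H x : x \in H -> x ^+ p \in powers p H.
Proof. by move=> Hx; apply: mem_gen; exists x. Qed.

Lemma mem_commutators H K x y :
  x \in H -> y \in K -> [~ x, y] \in commutators H K.
Proof. by move=> Hx Ky; apply: mem_gen; exists x, y. Qed.

Lemma join_sub H K S : group_closed S ->
  {subset H <= S} -> {subset K <= S} -> {subset join H K <= S}.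
Proof. by move=> gS HS KS x /genP; apply=> // y [/HS|/KS]. Qed.

Lemma powers_sub p H S : group_closed S ->
  (forall x, x \in H -> x ^+ p \in S) -> {subset powers p H <= S}.
Proof. by move=> gS HS x /genP; apply=> // y [z /HS Sz ->]. Qed.

Lemma commutators_sub H K S : group_closed S ->
  (forall x y, x \in H -> y \in K -> [~ x, y] \in S) ->
  {subset commutators H K <= S}.
Proof. by move=> gS HS x /genP; apply=> // y [u [v [Hu Kv ->]]]; apply: HS. Qed.

Lemma joinl H K : {subset H <= join H K}.
Proof. by move=> x Hx; apply: mem_gen; left. Qed.

Lemma joinr H K : {subset K <= join H K}.
Proof. by move=> x Hx; apply: mem_gen; right. Qed.

Section Closed.
Variables (S : {pred G}) (gS : group_closed S).
Lemma gr1 : 1 \in S. Proof. by case: gS. Qed.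
Lemma grM x y : x \in S -> y \in S -> x * y \in S.
Proof. exact: group_closedM. Qed.
Lemma grV x : x \in S -> x^-1 \in S.
Proof. exact: group_closedV. Qed.
Lemma grVE x : (x^-1 \in S) = (x \in S).
Proof. by apply/idP/idP => /grV; rewrite ?invgK. Qed.
Lemma grX n x : x \in S -> x ^+ n \in S.
Proof. by move=> Sx; elim: n => [|n IH]; [exact: gr1 | rewrite expgS grM]. Qed.
Lemma grMl x y : x \in S -> (x * y \in S) = (y \in S).
Proof.
move=> Sx; apply/idP/idP; last exact: grM.
by move=> /(grM (grV Sx)); rewrite mulKg.
Qed.
Lemma grMr x y : x \in S -> (y * x \in S) = (y \in S).
Proof.
move=> Sx; apply/idP/idP; last by move=> /grM; apply.
by move=> /grM/(_ (grV Sx)); rewrite mulgK.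
Qed.
Lemma grJ x y : x \in S -> y \in S -> x ^ y \in S.
Proof. by move=> Sx Sy; rewrite /conjg !grM// grV. Qed.
Lemma grR x y : x \in S -> y \in S -> [~ x, y] \in S.
Proof. by move=> Sx Sy; rewrite /commg grM ?grV ?grJ. Qed.
End Closed.

End Subgroups.

Arguments pderived1 G p : clear implicits.
Arguments pderived2 G p : clear implicits.
Arguments lcs G p n : clear implicits.

Section Morphisms.
Local Open Scope group_scope.
Variables (G G' : groupType).

(* [{multiplicative G -> G'}] only asks f to preserve products; between groups,
   this makes it a group morphism. *)
Variable f : {multiplicative G -> G'}.

Lemma gm1 : f 1 = 1.
Proof. by apply: (@mulgI _ (f 1)); rewrite -gmulfM !mulg1. Qed.

Lemma gmV x : f x^-1 = (f x)^-1.
Proof. by apply: (@mulgI _ (f x)); rewrite -gmulfM !mulgV gm1. Qed.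

Lemma gmJ x y : f (x ^ y) = f x ^ f y.
Proof. by rewrite /conjg !gmulfM gmV. Qed.

Lemma gmR x y : f [~ x, y] = [~ f x, f y].
Proof. by rewrite /commg gmulfM gmV gmJ. Qed.

Lemma gmX n x : f (x ^+ n) = f x ^+ n.
Proof. by elim: n => [|n IH]; rewrite ?gm1// !expgS gmulfM IH. Qed.

Lemma preim_group (S : {pred G'}) :
  group_closed S -> group_closed (preim f (mem S)).
Proof.
move=> gS; split; first by rewrite !inE gm1 gr1.
by move=> x y; rewrite !inE gmulfM gmV => *; rewrite grM// grV.
Qed.

Lemma join_morph (H K : {pred G}) (H' K' : {pred G'}) :
  (forall x, x \in H -> f x \in H') -> (forall x, x \in K -> f x \in K') ->
  forall x, x \in join H K -> f x \in join H' K'.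
Proof.
move=> fH fK x; apply: (@join_sub _ _ _ (preim f (mem (join H' K')))).
- exact/preim_group/gen_group.
- by move=> y /fH; exact: joinl.
- by move=> y /fK; exact: joinr.
Qed.

Lemma powers_morph p (H : {pred G}) (H' : {pred G'}) :
  (forall x, x \in H -> f x \in H') ->
  forall x, x \in powers p H -> f x \in powers p H'.
Proof.
move=> fH x; apply: (@powers_sub _ _ _ (preim f (mem (powers p H')))).
  exact/preim_group/gen_group.
move=> y /fH fy; suff: f (y ^+ p) \in powers p H' by [].

by rewrite gmX; exact: mem_powers.
Qed.

Lemma commutators_morph (H K : {pred G}) (H' K' : {pred G'}) :
  (forall x, x \in H -> f x \in H') -> (forall x, x \in K -> f x \in K') ->
  forall x, x \in commutators H K -> f x \in commutators H' K'.
Proof.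
move=> fH fK x.
apply: (@commutators_sub _ _ _ (preim f (mem (commutators H' K')))).
  exact/preim_group/gen_group.
move=> y z /fH fy /fK fz; suff: f [~ y, z] \in commutators H' K' by [].
by rewrite gmR; exact: mem_commutators.
Qed.

Lemma pderived_morph p (H : {pred G}) (H' : {pred G'}) :
  (forall x, x \in H -> f x \in H') ->
  forall x, x \in pderived p H -> f x \in pderived p H'.
Proof.
move=> fH; apply: join_morph; first exact: powers_morph.
exact: commutators_morph.
Qed.

Lemma pderived1_morph p x : x \in pderived1 G p -> f x \in pderived1 G' p.
Proof. exact: pderived_morph. Qed.

Lemma pderived2_morph p x : x \in pderived2 G p -> f x \in pderived2 G' p.
Proof. by apply: pderived_morph => y; exact: pderived1_morph. Qed.

Lemma lcs_morph p n x : x \in lcs G p n -> f x \in lcs G' p n.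
Proof.
case: n => [|n]//; elim: n => [|n IH]// in x *; rewrite !lcsS.
by apply: join_morph; [exact: powers_morph | exact: commutators_morph].
Qed.

End Morphisms.

Section Normal.
Local Open Scope group_scope.
Variable G : groupType.
Implicit Types (x y z : G).

Definition conjby y x := x ^ y.
Lemma conjbyM y : {morph conjby y : u v / u * v}.
Proof. by move=> u v; rewrite /conjby conjMg. Qed.
HB.instance Definition _ y :=
  isMultiplicative.Build G G (conjby y) (@conjbyM y).

Lemma pderived1J p x y : x \in pderived1 G p -> x ^ y \in pderived1 G p.
Proof. exact: (@pderived1_morph _ _ (conjby y)). Qed.

Lemma pderived2J p x y : x \in pderived2 G p -> x ^ y \in pderived2 G p.
Proof. exact: (@pderived2_morph _ _ (conjby y)). Qed.

Lemma lcsJ p n x y : x \in lcs G p n -> x ^ y \in lcs G p n.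
Proof. exact: (@lcs_morph _ _ (conjby y)). Qed.

Lemma lcsX p n x : x \in lcs G p n -> x ^+ p \in lcs G p n.+1.
Proof.
case: n => [|n] Hx //.
by apply: joinl; exact: mem_powers.
Qed.

Lemma lcsR p n x y : x \in lcs G p n -> [~ y, x] \in lcs G p n.+1.
Proof. by case: n => [|n] Hx //; apply: joinr; exact: mem_commutators. Qed.

Lemma lcsRl p n x y : x \in lcs G p n -> [~ x, y] \in lcs G p n.+1.
Proof. by rewrite -invgR (grVE (@lcs_group _ p n.+1)); exact: lcsR. Qed.

Lemma lcs_le p n : {subset lcs G p n.+1 <= lcs G p n}.
Proof.
case: n => // n; have gL := @lcs_group G p n.+1.
rewrite lcsS; apply: join_sub => //.
  by apply: powers_sub => // x Hx; exact: grX.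
apply: commutators_sub => // x y _ Hy.
by rewrite -invgR grVE// commgEl grMl ?grV// lcsJ.
Qed.

Lemma commMgJ x y z : [~ x * y, z] = [~ x, z] ^ y * [~ y, z].
Proof. by rewrite /commg /conjg !gnorm. Qed.

Lemma commVg x z : [~ x^-1, z] = ([~ x, z] ^ x^-1)^-1.
Proof. by rewrite /commg /conjg !gnorm. Qed.

Lemma hall_witt x y z :
  [~ x, y^-1, z] ^ y * [~ y, z^-1, x] ^ z * [~ z, x^-1, y] ^ x = 1.
Proof. by rewrite /commg /conjg !gnorm. Qed.

Lemma commXg_mod (N : {pred G}) n x y : group_closed N ->
    (forall u v, u \in N -> u ^ v \in N) -> (forall w, [~ x, y, w] \in N) ->
  exists2 u, u \in N & [~ x ^+ n, y] = [~ x, y] ^+ n * u.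
Proof.
move=> gN nN cN; elim: n => [|n [u Nu IH]].
  by exists 1; [exact: gr1 | rewrite comm1g mulg1].
exists ([~ x, y, x ^+ n] ^ ([~ x, y] ^+ n) * u); first by rewrite grM// nN.
rewrite expgS commMgJ IH -[_ ^ _ in LHS](mulVKg [~ x, y]) -commgEl.
by rewrite expgS /conjg !gnorm.
Qed.

Lemma lcsC p m n x y :
  x \in lcs G p m -> y \in lcs G p n -> [~ x, y] \in lcs G p (m + n).
Proof.
case: m => [|m] Hx Hy; first by rewrite lcs_le// lcsR.
elim: m n x y Hx Hy => [|m IH] n x y Hx Hy; first exact: lcsR.
have gL := @lcs_group G p (m.+2 + n).
pose P z := forall w, w \in lcs G p n -> [~ z, w] \in lcs G p (m.+2 + n).
pose S : {pred G} := fun z => `[< P z >].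
have SE z : reflect (P z) (z \in S) by exact: asboolP.
have gS : group_closed S.
  split; first by apply/SE => w _; rewrite comm1g gr1.
  move=> u v /SE Su /SE Sv; apply/SE => w Hw.
  by rewrite commMgJ commVg grM ?lcsJ ?Su ?grV ?lcsJ ?Sv.
suff : x \in S by move/SE; apply.
move: Hx; rewrite lcsS; apply: join_sub => // {x y Hy}.
  apply: powers_sub => // x Hx; apply/SE => y Hy.
  have Hxy := IH _ _ _ Hx Hy.
  have [|u Hu ->] := @commXg_mod (lcs G p (m.+2 + n)) p x y gL (@lcsJ _ _).
    by move=> w; rewrite lcsRl.
  by rewrite grM// lcsX.
apply: commutators_sub => // g x _ Hx; apply/SE => y Hy.
have gLm := @lcs_group G p m.+1; have gLn := @lcs_group G p n.
have HW := hall_witt g x^-1 y; rewrite invgK in HW.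
have H2 : [~ x^-1, y^-1, g] \in lcs G p (m.+2 + n).
  by rewrite lcsRl// IH ?grV.
have H3 : [~ y, g^-1, x^-1] \in lcs G p (m.+2 + n).
  rewrite -invgR grV// addSnnS IH ?grV//.
  exact: lcsRl.
have : [~ g, x, y] ^ x^-1 \in lcs G p (m.+2 + n).
  rewrite -(grMr gL _ (lcsJ y H2)) -(grMr gL _ (lcsJ g H3)) HW.
  exact: gr1.
by move/(@lcsJ _ _ _ x); rewrite conjgKV.
Qed.

End Normal.

Record nsec (G : groupType) := Nsec {
  sec_top : {pred G};
  sec_bot : {pred G};
  sec_topG : group_closed sec_top;
  sec_botG : group_closed sec_bot;
  sec_sub : {subset sec_bot <= sec_top};
  sec_norm : forall x y : G,
    x \in sec_bot -> y \in sec_top -> (x ^ y)%g \in sec_bot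
}.

Section Quotient.
Local Open Scope group_scope.
Local Open Scope quotient_scope.
Variables (G : groupType) (S : nsec G).

Record sec_elt := SecElt { sec_val : G; sec_valP : sec_val \in sec_top S }.
HB.instance Definition _ := [isSub for sec_val].
HB.instance Definition _ := [Choice of sec_elt by <:].
HB.instance Definition _ :=
  SubChoice_isSubGroup.Build G (sec_top S) sec_elt (sec_topG S).

Definition sec_eqv (x y : sec_elt) := (val x)^-1 * val y \in sec_bot S.

Lemma sec_eqv_class : equiv_class_of sec_eqv.
Proof.
have gN := sec_botG S; rewrite /sec_eqv; split => [x|x y|y x z xy yz].
- by rewrite mulVg gr1.
- by rewrite -(grVE gN) invgM invgK.
- by have := grM gN xy yz; rewrite -mulgA mulVKg.
Qed.
Canonical sec_eqv_equiv := EquivRelPack sec_eqv_class.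
Canonical sec_eqv_encModRel := defaultEncModRel sec_eqv.

Definition squot := {eq_quot sec_eqv}.
HB.instance Definition _ := Choice.on squot.

(* [cls x] is the class of x in H / N, when x \in H (and 1 otherwise). *)
Definition cls (x : G) : squot := \pi_squot (insubd (1 : sec_elt) x).
Definition rep (a : squot) : G := val (repr a).

Lemma rep_top a : rep a \in sec_top S.
Proof. exact: valP. Qed.

Lemma repK : cancel rep cls.
Proof. by move=> a; rewrite /cls /rep valKd reprK. Qed.

Lemma clsP x y : x \in sec_top S -> y \in sec_top S ->
  reflect (cls x = cls y) (x^-1 * y \in sec_bot S).
Proof.
move=> Hx Hy; apply: (iffP idP) => [xy|/eqmodP].
  by apply/eqmodP; rewrite /= /sec_eqv !val_insubd Hx Hy.
by rewrite /= /sec_eqv !val_insubd Hx Hy.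
Qed.

Lemma rep_cls x : x \in sec_top S -> x^-1 * rep (cls x) \in sec_bot S.
Proof. by move=> Hx; apply/clsP; rewrite ?rep_top ?repK. Qed.

Lemma rep_clsE x : x \in sec_top S ->
  exists2 u, u \in sec_bot S & rep (cls x) = x * u.
Proof. by move=> Hx; exists (x^-1 * rep (cls x)); rewrite ?mulVKg ?rep_cls. Qed.

Lemma clsMr x u : x \in sec_top S -> u \in sec_bot S -> cls (x * u) = cls x.
Proof.
move=> Hx Hu; have Hu' := sec_sub Hu; apply/esym/clsP => //.
  exact: (grM (sec_topG S)).
by rewrite mulKg.
Qed.

Lemma squot_ind (P : squot -> Prop) :
  (forall x, x \in sec_top S -> P (cls x)) -> forall a, P a.
Proof. by move=> HP a; rewrite -[a]repK; apply: HP; exact: rep_top. Qed.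

Definition smul (a b : squot) := cls (rep a * rep b).
Definition sinv (a : squot) := cls (rep a)^-1.

Lemma smulE x y : x \in sec_top S -> y \in sec_top S ->
  smul (cls x) (cls y) = cls (x * y).
Proof.
move=> Hx Hy; have [gH gN] := (sec_topG S, sec_botG S).
have [u Nu eu] := rep_clsE Hx; have [v Nv ev] := rep_clsE Hy.
have -> : smul (cls x) (cls y) = cls (x * y * (u ^ y * v)).
  by rewrite /smul eu ev /conjg !gnorm.
by apply: clsMr; [exact: grM | apply: grM => //; exact: sec_norm].
Qed.

Lemma sinvE x : x \in sec_top S -> sinv (cls x) = cls x^-1.
Proof.
move=> Hx; have [gH gN] := (sec_topG S, sec_botG S).
have [u Nu eu] := rep_clsE Hx.
have -> : sinv (cls x) = cls (x^-1 * u^-1 ^ x^-1).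
  by rewrite /sinv eu /conjg !gnorm.
by apply: clsMr; [exact: grV | apply: sec_norm; exact: grV].
Qed.

Lemma smulA : associative smul.
Proof.
have gH := sec_topG S.
elim/squot_ind=> x Hx; elim/squot_ind=> y Hy; elim/squot_ind=> z Hz.
by rewrite !smulE ?grM// mulgA.
Qed.

Lemma smul1 : left_id (cls 1) smul.
Proof.
have gH := sec_topG S.
by elim/squot_ind=> x Hx; rewrite smulE ?gr1// mul1g.
Qed.

Lemma smulr1 : right_id (cls 1) smul.
Proof.
have gH := sec_topG S.
by elim/squot_ind=> x Hx; rewrite smulE ?gr1// mulg1.
Qed.

Lemma smulV : left_inverse (cls 1) sinv smul.
Proof.
have gH := sec_topG S.
by elim/squot_ind=> x Hx; rewrite sinvE// smulE ?grV// mulVg.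
Qed.

Lemma smulrV : right_inverse (cls 1) sinv smul.
Proof.
have gH := sec_topG S.
by elim/squot_ind=> x Hx; rewrite sinvE// smulE ?grV// mulgV.
Qed.

HB.instance Definition _ :=
  isGroup.Build squot smulA smul1 smulr1 smulV smulrV.

Lemma clsM x y : x \in sec_top S -> y \in sec_top S ->
  cls (x * y) = cls x * cls y.
Proof. by move=> Hx Hy; rewrite -smulE. Qed.

End Quotient.

Section SectionMap.
Local Open Scope group_scope.
Variables (G G' : groupType) (S : nsec G) (S' : nsec G') (f : G -> G').

(* The map H / N -> H' / N' induced by a morphism f with f(H) <= H' and
   f(N) <= N'. *)
Definition smap (a : squot S) : squot S' := cls S' (f (rep a)).

Hypothesis fM : {morph f : x y / x * y}.
Hypothesis fH : forall x, x \in sec_top S -> f x \in sec_top S'.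
Hypothesis fN : forall x, x \in sec_bot S -> f x \in sec_bot S'.

Lemma smapE x : x \in sec_top S -> smap (cls S x) = cls S' (f x).
Proof.
move=> Hx; have [u Nu eu] := rep_clsE Hx.
by rewrite /smap eu fM clsMr ?fH ?fN.
Qed.

Lemma smapM : {morph smap : a b / a * b}.
Proof.
have gH := sec_topG S.
elim/squot_ind=> x Hx; elim/squot_ind=> y Hy.
by rewrite -clsM// !smapE ?grM// fM clsM ?fH.
Qed.

End SectionMap.

Record easec (p : nat) (G : groupType) := Easec {
  ea_sec :> nsec G;
  ea_comm : forall x y : G,
    x \in sec_top ea_sec -> y \in sec_top ea_sec ->
    [~ x, y]%g \in sec_bot ea_sec;
  ea_exp : forall x : G, x \in sec_top ea_sec -> (x ^+ p)%g \in sec_bot ea_sec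
}.

Section Vquot.
Local Open Scope ring_scope.
Variables (p : nat) (p_pr : prime p) (G : groupType) (S : easec p G).

(* H / N, written additively, with the action of 'F_p by multiples. *)
Definition vquot & prime p := squot S.
Local Notation V := (vquot p_pr).

Definition vcls (x : G) : V := cls S x.

HB.instance Definition _ := Choice.on V.

Let vadd (a b : V) : V := (a * b)%g.
Let vopp (a : V) : V := (a^-1)%g.
Let v0 : V := vcls 1.

Let vaddA : associative vadd. Proof. exact: smulA. Qed.
Let vadd0 : left_id v0 vadd. Proof. exact: smul1. Qed.
Let vaddN : left_inverse v0 vopp vadd. Proof. exact: smulV. Qed.
Let vaddC : commutative vadd.
Proof.
have gH := sec_topG S.
elim/squot_ind=> x Hx; elim/squot_ind=> y Hy; rewrite /vadd -!clsM//.
by rewrite commgC clsMr ?ea_comm// grM.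
Qed.

HB.instance Definition _ := GRing.isZmodule.Build V vaddA vaddC vadd0 vaddN.

Lemma vclsK (a : V) : vcls (rep a) = a. Proof. exact: repK. Qed.

Lemma vquot_ind (P : V -> Prop) :
  (forall x, x \in sec_top S -> P (vcls x)) -> forall a, P a.
Proof. exact: squot_ind. Qed.

Lemma vclsM x y : x \in sec_top S -> y \in sec_top S ->
  vcls (x * y)%g = vcls x + vcls y.
Proof. exact: clsM. Qed.

Lemma vclsP x y : x \in sec_top S -> y \in sec_top S ->
  reflect (vcls x = vcls y) ((x^-1 * y)%g \in sec_bot S).
Proof. exact: clsP. Qed.

Lemma vcls1 : vcls 1%g = 0. Proof. by []. Qed.

Lemma vclsV x : x \in sec_top S -> vcls (x^-1)%g = - vcls x.
Proof.
move=> Hx; apply/eqP; rewrite -addr_eq0 -vclsM ?mulVg ?vcls1//.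
exact: (grV (sec_topG S)).
Qed.

Lemma vcls_eq0 x : x \in sec_top S -> (vcls x == 0) = (x \in sec_bot S).
Proof.
move=> Hx; rewrite eq_sym -vcls1; apply/eqP/idP => [/vclsP|Nx].
  by rewrite invg1 mul1g; apply=> //; exact: (gr1 (sec_topG S)).
by apply/vclsP; rewrite ?invg1 ?mul1g//; exact: (gr1 (sec_topG S)).
Qed.

Lemma vcls_bot x : x \in sec_bot S -> vcls x = 0.
Proof. by move=> Nx; apply/eqP; rewrite vcls_eq0// (sec_sub Nx). Qed.

Lemma vclsX n x : x \in sec_top S -> vcls (x ^+ n)%g = vcls x *+ n.
Proof.
move=> Hx; elim: n => [|n IH]//.
by rewrite expgS vclsM ?(grX (sec_topG S))// IH mulrS.
Qed.

Lemma rep_vclsE x : x \in sec_top S ->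
  exists2 u, u \in sec_bot S & rep (vcls x) = (x * u)%g.
Proof. exact: rep_clsE. Qed.

Lemma vquot_torsion (a : V) : a *+ p = 0.
Proof.
by elim/vquot_ind: a => x Hx; rewrite -vclsX// vcls_bot// ea_exp.
Qed.

Lemma vquot_mod (a : V) n : a *+ (n %% p) = a *+ n.
Proof.
rewrite [in RHS](divn_eq n p) mulrnDr mulnC mulrnA vquot_torsion mul0rn.
by rewrite add0r.
Qed.

Let vquot_modF (a : V) n : a *+ (n %% (Zp_trunc (pdiv p)).+2) = a *+ n.
Proof. by rewrite Fp_cast// vquot_mod. Qed.

Let vscale (k : 'F_p) (a : V) : V := a *+ k.

Let vscaleA j k a : vscale j (vscale k a) = vscale (j * k) a.
Proof. by rewrite /vscale -mulrnA /= vquot_modF mulnC. Qed.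

Let vscale1 : left_id 1 vscale.
Proof. by move=> a; rewrite /vscale /= modn_small ?mulr1n. Qed.

Let vscaleDr : right_distributive vscale +%R.
Proof. by move=> k a b; rewrite /vscale mulrnDl. Qed.

Let vscaleDl a : {morph vscale^~ a : j k / j + k}.
Proof. by move=> j k; rewrite /vscale /= vquot_modF mulrnDr. Qed.

HB.instance Definition _ :=
  GRing.Zmodule_isLmodule.Build 'F_p V vscaleA vscale1 vscaleDr vscaleDl.

Lemma vscaleE (k : 'F_p) (a : V) : k *: a = a *+ k.
Proof. by []. Qed.

End Vquot.

Section VquotMap.
Local Open Scope ring_scope.
Variables (p : nat) (p_pr : prime p) (G G' : groupType).
Variables (S : easec p G) (S' : easec p G') (f : G -> G').

Lemma Fp_linear (h : vquot S p_pr -> vquot S' p_pr) :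
  {morph h : a b / a + b} -> linear h.
Proof.
move=> hD k a b; rewrite hD !vscaleE; congr (_ + _).
elim: (k : nat) => [|n IH]; last by rewrite !mulrS hD IH.
by rewrite !mulr0n; apply: (@addrI _ (h 0)); rewrite -hD !addr0.
Qed.

Definition vmap (a : vquot S p_pr) : vquot S' p_pr := smap S' f a.

Hypothesis fM : {morph f : x y / (x * y)%g}.
Hypothesis fH : forall x, x \in sec_top S -> f x \in sec_top S'.
Hypothesis fN : forall x, x \in sec_bot S -> f x \in sec_bot S'.

Lemma vmapE x : x \in sec_top S -> vmap (vcls p_pr S x) = vcls p_pr S' (f x).
Proof. exact: smapE. Qed.

Lemma vmap_linear : linear vmap.
Proof. by apply: Fp_linear; exact: smapM. Qed.

End VquotMap.

(* R[A] for an additively written abelian group A; [<< k >>] is the basis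
   element of R[A] attached to k : A. *)
Definition grpalg (R : nzRingType) (A : zmodType) := {malg R[A]}.

Section GroupAlgebra.
Local Open Scope ring_scope.
Variables (R : nzRingType) (A : zmodType).
Implicit Types (g : grpalg R A) (k l : A).

HB.instance Definition _ := GRing.Lmodule.on (grpalg R A).

Definition gaone : grpalg R A := << 0 >>.
Definition gamul g1 g2 : grpalg R A :=
  \sum_(k1 <- msupp g1) \sum_(k2 <- msupp g2) << g1@_k1 * g2@_k2 *g k1 + k2 >>.

(* Summation over the support of g of an expression that is additive in the
   coefficients. *)
Section Sums.
Variables (V : zmodType) (F : A -> R -> V).
Hypothesis F0 : forall k, F k 0 = 0.
Hypothesis FD : forall k, {morph F k : a b / a + b}.

Lemma gasum_fsub (d : {fset A}) g : (msupp g `<=` d)%fset ->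
  \sum_(k <- msupp g) F k g@_k = \sum_(k <- d) F k g@_k.
Proof.
by move=> le_d; apply: big_fset_incl => // k _ /mcoeff_outdom ->; rewrite F0.
Qed.

Lemma gasumD g1 g2 : \sum_(k <- msupp (g1 + g2)) F k (g1 + g2)@_k =
  \sum_(k <- msupp g1) F k g1@_k + \sum_(k <- msupp g2) F k g2@_k.
Proof.
pose d := (msupp g1 `|` msupp g2)%fset.
rewrite (@gasum_fsub d) ?msuppD_le// (@gasum_fsub d g1) ?fsubsetUl//.
rewrite (@gasum_fsub d g2) ?fsubsetUr// -big_split /=.
by apply: eq_bigr => k _; rewrite mcoeffD FD.
Qed.

Lemma gasumU k a : \sum_(l <- msupp (<< a *g k >> : grpalg R A))
  F l (<< a *g k >> : grpalg R A)@_l = F k a.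
Proof.
by rewrite (gasum_fsub msuppU_le) big_seq_fset1 mcoeffUU.
Qed.

Lemma gasum0 : \sum_(k <- msupp (0 : grpalg R A)) F k (0 : grpalg R A)@_k = 0.
Proof. by rewrite msupp0 big_seq_fset0. Qed.

End Sums.

Lemma ga_ind (P : grpalg R A -> Prop) :
  P 0 -> (forall g1 g2, P g1 -> P g2 -> P (g1 + g2)) ->
  (forall a k, P << a *g k >>) -> forall g, P g.
Proof. by move=> P0 PD PU g; rewrite [g]monalgE; apply: big_ind. Qed.

Lemma gamulDl : left_distributive gamul +%R.
Proof.
move=> g1 g2 g; apply: (gasumD (F := fun k1 a =>
  \sum_(k2 <- msupp g) << a * g@_k2 *g k1 + k2 >>)) => k.
  by rewrite big1// => k2 _; rewrite mul0r monalgU0.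
move=> a b; rewrite -big_split /=; apply: eq_bigr => k2 _.
by rewrite mulrDl monalgUD.
Qed.

Lemma gamulDr : right_distributive gamul +%R.
Proof.
move=> g g1 g2; rewrite /gamul -big_split /=; apply: eq_bigr => k1 _.
apply: (gasumD (F := fun k2 a => << g@_k1 * a *g k1 + k2 >>)) => k.
  by rewrite mulr0 monalgU0.
by move=> a b; rewrite mulrDr monalgUD.
Qed.

Lemma gamul0l : left_zero 0 gamul.
Proof. by move=> g; rewrite /gamul msupp0 big_seq_fset0. Qed.

Lemma gamul0r : right_zero 0 gamul.
Proof.
by move=> g; rewrite /gamul big1// => k _; rewrite msupp0 big_seq_fset0.
Qed.

Lemma gamulUU a b k l :
  gamul << a *g k >> << b *g l >> = << a * b *g k + l >>.
Proof.
rewrite /gamul (gasumU (F := fun k1 a =>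
  \sum_(k2 <- msupp _) << a * _@_k2 *g k1 + k2 >>)).
- rewrite (gasumU (F := fun k2 b => << a * b *g k + k2 >>))// => k'.
  by rewrite mulr0 monalgU0.
- by move=> k'; rewrite big1// => k2 _; rewrite mul0r monalgU0.
Qed.

Lemma gamul1l : left_id gaone gamul.
Proof.
elim/ga_ind => [|g1 g2 IH1 IH2|a k]; first exact: gamul0r.
  by rewrite gamulDr IH1 IH2.
by rewrite gamulUU mul1r add0r.
Qed.

Lemma gamul1r : right_id gaone gamul.
Proof.
elim/ga_ind => [|g1 g2 IH1 IH2|a k]; first exact: gamul0l.
  by rewrite gamulDl IH1 IH2.
by rewrite gamulUU mulr1 addr0.
Qed.

Lemma gamulA : associative gamul.
Proof.
move=> g1 g2 g3; elim/ga_ind: g1 => [|u v IHu IHv|a k].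
- by rewrite !gamul0l.
- by rewrite !gamulDl IHu IHv.
elim/ga_ind: g2 => [|u v IHu IHv|b l].
- by rewrite !(gamul0r, gamul0l).
- by rewrite !(gamulDr, gamulDl) IHu IHv.
elim/ga_ind: g3 => [|u v IHu IHv|c m].
- by rewrite !gamul0r.
- by rewrite !gamulDr IHu IHv.
by rewrite !gamulUU mulrA addrA.
Qed.

Lemma gaone_neq0 : gaone != 0.
Proof. by rewrite monalgU_eq0 oner_eq0. Qed.

HB.instance Definition _ := GRing.Zmodule_isNzRing.Build (grpalg R A)
  gamulA gamul1l gamul1r gamulDl gamulDr gaone_neq0.

Lemma gaU_mul a b k l :
  (<< a *g k >> : grpalg R A) * << b *g l >> = << a * b *g k + l >>.
Proof. exact: gamulUU. Qed.

End GroupAlgebra.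

(* The ring morphism R[A] -> R[A'] induced by an additive map A -> A'. *)
Section GroupAlgebraMap.
Local Open Scope ring_scope.
Variables (R : nzRingType) (A A' : zmodType) (f : {additive A -> A'}).

Definition gamap (g : grpalg R A) : grpalg R A' :=
  \sum_(k <- msupp g) << g@_k *g f k >>.

Let F0 k : << (0 : R) *g f k >> = 0 :> grpalg R A'.
Proof. exact: monalgU0. Qed.
Let FD k : {morph (fun a : R => << a *g f k >> : grpalg R A') : a b / a + b}.
Proof. by move=> a b; rewrite monalgUD. Qed.

Lemma gamapD : {morph gamap : g1 g2 / g1 + g2}.
Proof. by move=> g1 g2; apply: (gasumD (F := fun k a => << a *g f k >>)). Qed.

Lemma gamapU a k : gamap << a *g k >> = << a *g f k >>.
Proof. exact: (gasumU (F := fun k a => << a *g f k >>)). Qed.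

Lemma gamap0 : gamap 0 = 0.
Proof. by rewrite /gamap msupp0 big_seq_fset0. Qed.

Lemma gamap_zmod : zmod_morphism gamap.
Proof.
by move=> g1 g2; apply/eqP; rewrite eq_sym subr_eq -gamapD subrK.
Qed.

Lemma gamap_monoid : monoid_morphism gamap.
Proof.
split=> [|g1 g2]; first by rewrite gamapU raddf0.
elim/ga_ind: g1 => [|u v IHu IHv|a k].
- by rewrite !(mul0r, gamap0).
- by rewrite !(mulrDl, gamapD) IHu IHv.
elim/ga_ind: g2 => [|u v IHu IHv|b l].
- by rewrite !(mulr0, gamap0).
- by rewrite !(mulrDr, gamapD) IHu IHv.
by rewrite gaU_mul !gamapU gaU_mul raddfD.
Qed.

HB.instance Definition _ := GRing.isZmodMorphism.Build _ _ gamap gamap_zmod.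
HB.instance Definition _ := GRing.isMonoidMorphism.Build _ _ gamap gamap_monoid.

End GroupAlgebraMap.

(* The R[A]-module structure attached to an action of A on an R-module V by
   additive maps commuting with the scalars. *)
Section GroupAlgebraModule.
Local Open Scope ring_scope.
Variables (R : nzRingType) (A : zmodType) (V : lmodType R) (act : A -> V -> V).

Definition gascale (g : grpalg R A) (v : V) : V :=
  \sum_(k <- msupp g) g@_k *: act k v.

Hypothesis act_linear : forall k, linear (act k).
Hypothesis act0 : forall v, act 0 v = v.
Hypothesis actD : forall k l v, act (k + l) v = act k (act l v).

Let act_at k v w : act k (v + w) = act k v + act k w.
Proof. by have := act_linear k 1 v w; rewrite !scale1r. Qed.
Let act_0 k : act k 0 = 0.
Proof. by apply: (@addrI _ (act k 0)); rewrite -act_at !addr0. Qed.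
Let actZ k a v : act k (a *: v) = a *: act k v.
Proof. by have := act_linear k a v 0; rewrite act_0 !addr0. Qed.

Lemma gascaleU a k v : gascale << a *g k >> v = a *: act k v.
Proof.
by apply: (gasumU (F := fun k a => a *: act k v)) => l; rewrite scale0r.
Qed.

Lemma gascaleDl v : {morph gascale^~ v : g1 g2 / g1 + g2}.
Proof.
move=> g1 g2; apply: (gasumD (F := fun k a => a *: act k v)) => l.
  by rewrite scale0r.
by move=> a b; rewrite scalerDl.
Qed.

Lemma gascaleDr : right_distributive gascale +%R.
Proof.
move=> g v w; rewrite /gascale -big_split /=; apply: eq_bigr => k _.
by rewrite act_at scalerDr.
Qed.

Lemma gascale1 : left_id 1 gascale.
Proof. by move=> v; rewrite gascaleU scale1r act0. Qed.

Let gascale0 v : gascale 0 v = 0.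
Proof. by rewrite /gascale msupp0 big_seq_fset0. Qed.
Let gascaler0 g : gascale g 0 = 0.
Proof. by rewrite /gascale big1// => k _; rewrite act_0 scaler0. Qed.

Lemma gascaleA g1 g2 v : gascale g1 (gascale g2 v) = gascale (g1 * g2) v.
Proof.
elim/ga_ind: g1 => [|u w IHu IHw|a k].
- by rewrite mul0r !gascale0.
- by rewrite mulrDl !gascaleDl IHu IHw.
elim/ga_ind: g2 => [|u w IHu IHw|b l].
- by rewrite mulr0 !gascale0 gascaler0.
- by rewrite mulrDr !gascaleDl gascaleDr IHu IHw.
by rewrite gaU_mul !gascaleU actZ scalerA actD.
Qed.

End GroupAlgebraModule.

Section Invariants.
Local Open Scope ring_scope.
Variables (p : nat) (p_pr : prime p) (G : groupType).

Lemma pderived1_group : group_closed (pderived1 G p).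
Proof. exact: gen_group. Qed.

Lemma pderived2_group : group_closed (pderived2 G p).
Proof. exact: gen_group. Qed.

Lemma pderived2_sub : {subset pderived2 G p <= pderived1 G p}.
Proof.
have gD := pderived1_group; apply: join_sub => //.
  by apply: powers_sub => // x Hx; exact: grX.
by apply: commutators_sub => // x y Hx Hy; exact: grR.
Qed.

Lemma pderivedR (H : {pred G}) x y :
  x \in H -> y \in H -> [~ x, y]%g \in pderived p H.
Proof. by move=> Hx Hy; apply: joinr; exact: mem_commutators. Qed.

Lemma pderivedX (H : {pred G}) x : x \in H -> (x ^+ p)%g \in pderived p H.
Proof. by move=> Hx; apply: joinl; exact: mem_powers. Qed.

Definition H1_sec : easec p G := @Easec p G
  (@Nsec G predT (pderived1 G p) (@predT_group G) pderived1_group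
     (fun x _ => isT) (fun x y Hx _ => pderived1J y Hx))
  (@pderivedR predT) (@pderivedX predT).

Definition B_sec : easec p G := @Easec p G
  (@Nsec G (pderived1 G p) (pderived2 G p) pderived1_group pderived2_group
     pderived2_sub (fun x y Hx _ => pderived2J y Hx))
  (@pderivedR (pderived1 G p)) (@pderivedX (pderived1 G p)).

Definition metab_sec : nsec G := @Nsec G predT (pderived2 G p)
  (@predT_group G) pderived2_group (fun x _ => isT)
  (fun x y Hx _ => pderived2J y Hx).

(* H_1(G; Z_p) = G / G'_p *)
Definition H1 : lmodType 'F_p := vquot H1_sec p_pr.

(* G / G''_p *)
Definition metab : groupType := squot metab_sec.

(* B_p(G) = G'_p / G''_p, with the action (x G'_p) . (y G''_p) = x y x^-1 G''_p
   of H_1(G; Z_p); recall that y ^ x is x^-1 y x. *)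
Definition Balex := vquot B_sec p_pr.

Definition Bact (h : H1) (b : Balex) : Balex :=
  vcls p_pr B_sec (rep b ^ (rep h)^-1)%g.

Lemma BactE x y : y \in pderived1 G p ->
  Bact (vcls p_pr H1_sec x) (vcls p_pr B_sec y) = vcls p_pr B_sec (y ^ x^-1)%g.
Proof.
move=> Hy; have gD := pderived1_group.
have [u Hu eu] := @rep_vclsE _ p_pr _ B_sec y Hy.
have [v Hv ev] := @rep_vclsE _ p_pr _ H1_sec x isT.
have -> : Bact (vcls p_pr H1_sec x) (vcls p_pr B_sec y) =
          vcls p_pr B_sec (((y * [~ y, v^-1]) * u ^ v^-1) ^ x^-1)%g.
  by rewrite /Bact eu ev /commg /conjg !gnorm.
have Hu1 := pderived2_sub Hu.
rewrite conjMg vclsM ?pderived1J ?grM ?grR ?grV//.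
rewrite [X in _ + X]vcls_bot ?addr0; last by rewrite !pderived2J.
rewrite conjMg vclsM ?pderived1J ?grM ?grR ?grV//.
by rewrite [X in _ + X]vcls_bot ?addr0//= pderived2J// pderivedR// grV.
Qed.

Lemma Bact_linear h : linear (Bact h).
Proof.
have gD := pderived1_group.
elim/vquot_ind: h => x _; apply: Fp_linear.
elim/vquot_ind=> y Hy; elim/vquot_ind=> z Hz.
by rewrite -vclsM// !BactE ?grM// conjMg vclsM// pderived1J.
Qed.

Lemma Bact0 b : Bact 0 b = b.
Proof. by elim/vquot_ind: b => y Hy; rewrite -vcls1 BactE// invg1 conjg1. Qed.

Lemma BactD h k b : Bact (h + k) b = Bact h (Bact k b).
Proof.
elim/vquot_ind: b => y Hy; elim/vquot_ind: h => u _; elim/vquot_ind: k => v _.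
by rewrite -vclsM// !BactE ?pderived1J// invgM conjgM.
Qed.

(* The mod-p Alexander invariant, as a Z_p[H_1(G; Z_p)]-module. *)
Definition Bp := Balex.
HB.instance Definition _ := GRing.Zmodule.on Bp.
HB.instance Definition _ :=
  GRing.Zmodule_isLmodule.Build (grpalg 'F_p H1) Bp
    (gascaleA Bact_linear BactD) (gascale1 Bact0) (gascaleDr Bact_linear)
    (@gascaleDl _ _ _ Bact).

End Invariants.

Section Functoriality.
Local Open Scope ring_scope.
Variables (p : nat) (p_pr : prime p) (G G' : groupType).
Variable f : {multiplicative G -> G'}.

Definition H1_map : H1 p_pr G -> H1 p_pr G' := vmap (H1_sec p G') f.

Lemma H1_map_linear : linear H1_map.
Proof.
by apply: vmap_linear => //; [exact: gmulfM | exact: pderived1_morph].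
Qed.
HB.instance Definition _ :=
  GRing.isLinear.Build 'F_p (H1 p_pr G) (H1 p_pr G') _ H1_map H1_map_linear.

Definition Bp_map : Bp p_pr G -> Bp p_pr G' := vmap (B_sec p G') f.

Definition metab_map : metab p G -> metab p G' := smap (metab_sec p G') f.

Lemma metab_mapM : {morph metab_map : a b / (a * b)%g}.
Proof.
by apply: smapM => //; [exact: gmulfM | exact: pderived2_morph].
Qed.
HB.instance Definition _ :=
  isMultiplicative.Build (metab p G) (metab p G') metab_map metab_mapM.

End Functoriality.

Arguments H1_map {p} p_pr {G G'} f a.
Arguments Bp_map {p} p_pr {G G'} f a.
Arguments metab_map p {G G'} f a.

Section GradedLie.
Local Open Scope ring_scope.
Variable F : fieldType.

Definition gcast (L : nat -> lmodType F) m n (e : m = n) (x : L m) : L n :=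
  ecast k (L k) e x.

(* A graded Lie algebra, given by its homogeneous parts; together with
   bilinearity, [gl_alt] and [gl_anti] say that the bracket is alternating on
   the direct sum of the parts. *)
Record gradedLie := GradedLie {
  gl_part :> nat -> lmodType F;
  gl_br : forall m n, gl_part m -> gl_part n -> gl_part (m + n)%N;
  gl_linl : forall m n (y : gl_part n), linear (fun x : gl_part m => gl_br x y);
  gl_linr : forall m n (x : gl_part m), linear (fun y : gl_part n => gl_br x y);
  gl_alt : forall n (x : gl_part n), gl_br x x = 0;
  gl_anti : forall m n (x : gl_part m) (y : gl_part n) (e : (n + m = m + n)%N),
    gl_br x y = - gcast e (gl_br y x);
  gl_jacobi : forall i j k (x : gl_part i) (y : gl_part j) (z : gl_part k)
      (e1 : (j + (k + i) = i + (j + k))%N) (e2 : (k + (i + j) = i + (j + k))%N),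
    gl_br x (gl_br y z) + gcast e1 (gl_br y (gl_br z x))
      + gcast e2 (gl_br z (gl_br x y)) = 0
}.

(* f is an isomorphism from the part of degree >= d of L to that of M. *)
Definition gl_iso_ge d (L M : gradedLie) (f : forall n, L n -> M n) : Prop :=
  [/\ forall n, (d <= n)%N -> linear (f n),
      forall n, (d <= n)%N -> bijective (f n)
    & forall m n (x : L m) (y : L n), (d <= m)%N -> (d <= n)%N ->
        f (m + n)%N (gl_br x y) = gl_br (f m x) (f n y)].

End GradedLie.

Section AssociatedGraded.
Local Open Scope ring_scope.
Variables (p : nat) (p_pr : prime p) (G : groupType).

Definition gr_sec n : easec p G := @Easec p G
  (@Nsec G (lcs G p n) (lcs G p n.+1) (@lcs_group G p n) (@lcs_group G p n.+1)
     (@lcs_le G p n) (fun x y Hx _ => lcsJ y Hx))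
  (fun x y _ Hy => lcsR x Hy) (@lcsX G p n).

Definition gr n : lmodType 'F_p := vquot (gr_sec n) p_pr.

Local Notation cl n x := (vcls p_pr (gr_sec n) x).

Definition gr_br m n (a : gr m) (b : gr n) : gr (m + n)%N :=
  cl (m + n) [~ rep a, rep b]%g.

Lemma clJ n x y : x \in lcs G p n -> cl n (x ^ y)%g = cl n x.
Proof.
move=> Hx; have gL := @lcs_group G p n.
have -> : (x ^ y)%g = (x * [~ x, y])%g by rewrite commgEl mulVKg.
by rewrite vclsM ?[X in _ + X]vcls_bot ?addr0 ?lcsRl// lcs_le// lcsRl.
Qed.

Lemma cl_brMl m n x z y :
  x \in lcs G p m -> z \in lcs G p m -> y \in lcs G p n ->
  cl (m + n) [~ x * z, y]%g = cl (m + n) [~ x, y]%g + cl (m + n) [~ z, y]%g.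
Proof. by move=> Hx Hz Hy; rewrite commMgJ vclsM ?lcsJ ?lcsC// clJ ?lcsC. Qed.

Lemma cl_anti m n x y : x \in lcs G p m -> y \in lcs G p n ->
  cl (m + n) [~ x, y]%g = - cl (m + n) [~ y, x]%g.
Proof.
move=> Hx Hy; rewrite -vclsV ?invgR//.
by rewrite -invgR (grVE (@lcs_group G p (m + n))) lcsC.
Qed.

Lemma cl_brMr m n x y z :
  x \in lcs G p m -> y \in lcs G p n -> z \in lcs G p n ->
  cl (m + n) [~ x, y * z]%g = cl (m + n) [~ x, y]%g + cl (m + n) [~ x, z]%g.
Proof.
move=> Hx Hy Hz; have gL := @lcs_group G p n.
rewrite cl_anti ?grM// addnC cl_brMl// opprD.
by rewrite [cl _ [~ y, x]%g]cl_anti// [cl _ [~ z, x]%g]cl_anti// !opprK addnC.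
Qed.

Lemma gr_brE m n x y : x \in lcs G p m -> y \in lcs G p n ->
  gr_br (cl m x) (cl n y) = cl (m + n) [~ x, y]%g.
Proof.
move=> Hx Hy; have [gm gn] := (@lcs_group G p m, @lcs_group G p n).
have [u Hu eu] := @rep_vclsE _ p_pr _ (gr_sec m) x Hx.
have [v Hv ev] := @rep_vclsE _ p_pr _ (gr_sec n) y Hy.
have [Hu' Hv'] := (lcs_le Hu, lcs_le Hv).
rewrite /gr_br eu ev cl_brMl ?grM// !cl_brMr//.
rewrite [cl _ [~ x, v]%g]vcls_bot; last by rewrite /= -addnS lcsC.
rewrite [cl _ [~ u, y]%g]vcls_bot; last by rewrite /= -addSn lcsC.
rewrite [cl _ [~ u, v]%g]vcls_bot; last by rewrite /= -addSn lcsC.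
by rewrite !addr0.
Qed.

Lemma gr_linl m n (b : gr n) : linear (fun a : gr m => gr_br a b).
Proof.
have gm := @lcs_group G p m.
elim/vquot_ind: b => y Hy; apply: Fp_linear.
elim/vquot_ind=> x Hx; elim/vquot_ind=> z Hz.
by rewrite -vclsM// !gr_brE ?grM// cl_brMl.
Qed.

Lemma gr_brNl m n (a : gr m) (b : gr n) : gr_br (- a) b = - gr_br a b.
Proof.
have E c := gr_linl b 1 c (0 : gr m); have E1 := gr_linl b 1 a (- a).
have E0 := E 0; rewrite /= !scale1r !addr0 in E0 E1.
have {}E0 : gr_br (0 : gr m) b = 0.
  by apply: (@addrI _ (gr_br (0 : gr m) b)); rewrite addr0.
by apply/eqP; rewrite -addr_eq0 addrC -E1 subrr E0.
Qed.

Lemma gr_linr m n (a : gr m) : linear (fun b : gr n => gr_br a b).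
Proof.
have gn := @lcs_group G p n.
elim/vquot_ind: a => x Hx; apply: Fp_linear.
elim/vquot_ind=> y Hy; elim/vquot_ind=> z Hz.
by rewrite -vclsM// !gr_brE ?grM// cl_brMr.
Qed.

Lemma gr_alt n (a : gr n) : gr_br a a = 0.
Proof. by rewrite /gr_br commgg vcls1. Qed.

Lemma gcast_cl m n (e : m = n) x : gcast e (cl m x : gr m) = cl n x.
Proof. by case: n / e. Qed.

Lemma gr_anti m n (a : gr m) (b : gr n) (e : (n + m = m + n)%N) :
  gr_br a b = - gcast e (gr_br b a).
Proof. by rewrite gcast_cl /gr_br -cl_anti ?rep_top. Qed.

Lemma gr_jacobi i j k (a : gr i) (b : gr j) (c : gr k)
    (e1 : (j + (k + i) = i + (j + k))%N) (e2 : (k + (i + j) = i + (j + k))%N) :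
  gr_br a (gr_br b c) + gcast e1 (gr_br b (gr_br c a))
    + gcast e2 (gr_br c (gr_br a b)) = 0.
Proof.
elim/vquot_ind: a => x Hx; elim/vquot_ind: b => y Hy; elim/vquot_ind: c => z Hz.
rewrite !gr_brE ?lcsC// !gcast_cl.
have gr_ n := @lcs_group G p n.
have anti2 l l1 l2 l3 (e : (l1 + (l2 + l3) = l)%N) u v w :
    u \in lcs G p l1 -> v \in lcs G p l2 -> w \in lcs G p l3 ->
    cl l [~ u, [~ v, w]]%g = cl l [~ v, w^-1, u]%g.
  move=> Hu Hv Hw; rewrite -e.
  have Hvw := lcsC Hv Hw; have Hw' := grV (gr_ _) Hw.
  have Hvw' := lcsC Hv Hw'.
  have Evw : cl (l2 + l3) [~ v, w]%g = - cl (l2 + l3) [~ v, w^-1]%g.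
    by apply/eqP; rewrite -addr_eq0 -cl_brMr// mulgV commg1 vcls1.
  by rewrite cl_anti// addnC -gr_brE// Evw gr_brNl opprK gr_brE.
rewrite (anti2 _ i j k)// (anti2 _ j k i)// (anti2 _ k i j)//.
have HW := congr1 (vcls p_pr (gr_sec (i + (j + k)))) (hall_witt x y z).
have M1 : [~ y, z^-1, x]%g \in lcs G p (i + (j + k)).
  by rewrite addnC !lcsC// grV.
have M2 : [~ z, x^-1, y]%g \in lcs G p (i + (j + k)).
  by rewrite -e1 addnC !lcsC// grV.
have M3 : [~ x, y^-1, z]%g \in lcs G p (i + (j + k)).
  by rewrite -e2 addnC !lcsC// grV.
have [J1 J2 J3] := And3 (lcsJ z M1) (lcsJ x M2) (lcsJ y M3).
have J13 := grM (gr_ _) J3 J1.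
move: HW; rewrite vcls1 vclsM//= vclsM//= !clJ// => <-.
by rewrite addrC addrA.
Qed.

Definition gr_lie : gradedLie 'F_p :=
  GradedLie gr_linl gr_linr gr_alt gr_anti gr_jacobi.

End AssociatedGraded.

Section GradedMap.
Variables (p : nat) (p_pr : prime p) (G G' : groupType).
Variable f : {multiplicative G -> G'}.

(* gr^p(f), as a morphism of graded Lie algebras gr^p(G) -> gr^p(G') *)
Definition gr_map n : gr_lie p_pr G n -> gr_lie p_pr G' n :=
  vmap (gr_sec p G' n) f.

Lemma gr_map_linear n : linear (@gr_map n).
Proof.
by apply: vmap_linear; [exact: gmulfM | exact: lcs_morph..].
Qed.

Lemma gr_map_br m n (a : gr_lie p_pr G m) (b : gr_lie p_pr G n) :
  gr_map (gl_br a b) = gl_br (gr_map a) (gr_map b).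
Proof.
elim/vquot_ind: a => x Hx; elim/vquot_ind: b => y Hy.
pose cl G0 k z : gr p_pr G0 k := vcls p_pr (gr_sec p G0 k) z.
have E k z : z \in lcs G p k -> @gr_map k (cl G k z) = cl G' k (f z).
  by move=> Hz; apply: vmapE => //; [exact: gmulfM | exact: lcs_morph..].
suff : gr_map (gr_br (cl G m x) (cl G n y)) =
       gr_br (gr_map (cl G m x)) (gr_map (cl G n y)) by [].
by rewrite gr_brE// (E m)// (E n)// gr_brE ?lcs_morph// E ?lcsC// gmR.
Qed.

End GradedMap.

Arguments gr_map {p} p_pr {G G'} f n a.

Section Dimension.
Local Open Scope ring_scope.
Variables (F : fieldType) (V : lmodType F).

Definition has_dim (d : nat) := exists f : {linear V -> 'rV[F]_d}, bijective f.
Definition fin_dim := exists d, has_dim d.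

(* The dimension of V when V is finite-dimensional, and 0 otherwise. *)
Definition dimension : nat := xget 0%N [set d | has_dim d]%classic.

Lemma has_dim_le d e : has_dim d -> has_dim e -> (d <= e)%N.
Proof.
move=> [f [f' fK f'K]] [g [g' gK _]].
have f'L : linear f' by apply: can2_linear fK f'K.
pose h v := g (f' v).
have hL : linear h by move=> a u v; rewrite /h f'L linearP.
pose hl : {linear _ -> _} := HB.pack h (GRing.isLinear.Build _ _ _ _ h hL).
suff /eqP <- : row_free (lin1_mx hl) by exact: rank_leq_col.
apply: inj_row_free => v; rewrite mul_rV_lin1 /= /h => gv0.
apply: (can_inj f'K); apply: (can_inj gK).
by rewrite gv0 -(linear0 f) fK linear0.
Qed.

Lemma dimensionP d : has_dim d -> dimension = d.
Proof.
move=> Vd; apply: xget_unique => // e Ve.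
by apply/eqP; rewrite eqn_leq !has_dim_le.
Qed.

End Dimension.

Section Numerics.
Variables (p : nat) (p_pr : prime p) (G : groupType).

Definition b1_finite := fin_dim (H1 p_pr G).
Definition phi n := dimension (gr p_pr G n).
Definition theta n := dimension (gr p_pr (metab p G) n).

End Numerics.

Section ExactSequences.
Variables (K G Q : groupType).
Variables (i : {multiplicative K -> G}) (q : {multiplicative G -> Q}).

Definition short_exact :=
  [/\ injective i, forall x, q x = 1%g <-> exists y, i y = x
    & forall z, exists x, q x = z].

Definition p_exact p (p_pr : prime p) :=
  short_exact /\
  [/\ injective (H1_map p_pr i),
      forall x, H1_map p_pr q x = 0%R <-> exists y, H1_map p_pr i y = x
    & forall z, exists x, H1_map p_pr q x = z].

Definition is_split := exists s : {multiplicative Q -> G}, cancel s q.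

Definition elementary_abelian p :=
  (forall x y : Q, (x * y = y * x)%g) /\ (forall x : Q, x ^+ p = 1)%g.

End ExactSequences.

(* Main.v *)
Require Import Defs.
From HB Require Import structures.
From mathcomp Require Import finmap.
From mathcomp.multinomials Require Import monalg.
From mathcomp Require Import all_boot all_algebra.
From mathcomp Require Import boolp classical_sets.

Import GRing.Theory.
Local Open Scope ring_scope.

(** Everything follows from one fact: [iota] maps K'_p onto G'_p
    ([p_exact_same_pderived1]). As Q is elementary abelian, G'_p dies in Q,
    hence lies in [iota K]; an element [iota y] of G'_p vanishes in
    H_1(G; Z_p), so injectivity of H_1(K; Z_p) -> H_1(G; Z_p) puts [y] in K'_p.
    Then [iota] also maps K''_p onto G''_p, and therefore B_p(K) onto B_p(G):
    this is (1).

    For the graded Lie algebras, identify K with its image. An element [g] of G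
    acts on K by conjugation; since [[K, g] <= G'_p = K'_p], this automorphism
    of K is trivial on K / K'_p. An endomorphism with that property is trivial
    on the whole of gr^p(K), which is generated from degree 1 by brackets and
    p-th powers ([gr_eq_from_degree1]). So [[G, gamma_n(K)] <= gamma_(n+1)(K)],
    and induction from G'_p = K'_p gives gamma_n(G) = gamma_n(K) for every
    n >= 2 ([lcs_image]). Hence gr^p(K) -> gr^p(G) is injective in degrees >= 1
    and bijective in degrees >= 2.

    The map K / K''_p -> G / G''_p is again injective and again maps the first
    p-derived subgroup onto the first p-derived subgroup
    ([metab_same_pderived1]), so the same argument applies to it.

    The numerical statements need in addition that gr^p_n is finite-dimensional
    as soon as H_1 is ([gr_fin_dim]): gr^p_(n+1) is spanned by the brackets of
    gr^p_1 with gr^p_n and by the p-th powers of gr^p_n, and over Z_p a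
    finite-dimensional space is a finite set. *)

Set Implicit Arguments.
Unset Strict Implicit.

(** * Finite-dimensional vector spaces *)

Section FiniteDimension.

(** The kernel of [s] has a complement, on which [s] is bijective; kernel and
    complement are represented by the row spaces of [A] and of [A^C]. *)
Lemma fin_dim_linear_image (F : fieldType) (V : lmodType F) n
    (s : {linear 'rV[F]_n -> V}) :
  (forall v, exists u, s u = v) -> fin_dim V.
Proof.
move=> s_surj.
pose ker r :=
  `[< exists2 A : 'M[F]_n, (forall u, s (u *m A) = 0) & \rank A = r >].
have ker0 : exists r, ker r.
  exists 0%N; apply/asboolP; exists 0; rewrite ?mxrank0// => u.
  by rewrite mulmx0 linear0.
have ker_le r : ker r -> (r <= n)%N.
  by move=> /asboolP[A _ <-]; exact: rank_leq_row.
(* A matrix of maximal rank among those with rows in the kernel of s has the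
   whole kernel as its row space. *)
case: (ex_maxnP ker0 ker_le) => r /asboolP[A sA rA] r_max.
pose C := row_base (A^C)%MS.
pose h u := s (u *m C).
have hL : linear h by move=> a u v; rewrite /h mulmxDl -scalemxAl linearP.
pose hl : {linear _ -> _} := HB.pack h (GRing.isLinear.Build _ _ _ _ h hL).
have h0 u : h u = 0 -> u = 0.
  move=> hu0; pose w := u *m C.
  have /r_max le_r : ker (\rank (A + w)%MS).
    apply/asboolP; exists (A + w)%MS => // v.
    have /sub_addsmxP[[a b] /= ->] : (v *m (A + w)%MS <= A + w)%MS.
      exact: submxMl.
    rewrite linearD sA add0r [b]mx11_scalar mul_scalar_mx linearZ /= -/(h u).
    by rewrite hu0 scaler0.
  have wA : (w <= A)%MS.
    have [_ eqA] := mxrank_leqif_sup (addsmxSl A w).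
    apply: submx_trans (addsmxSr A w) _.
    by rewrite -eqA eqn_leq rA le_r andbT -rA mxrankS// addsmxSl.
  have wC : (w <= A^C)%MS.
    by apply: submx_trans (submxMl _ _) _; rewrite eq_row_base.
  have : (w <= A :&: A^C)%MS by rewrite sub_capmx wA.
  rewrite capmx_compl submx0 => /eqP w0.
  have /row_freeP[D CD] : row_free C by exact: row_base_free.
  by rewrite -[u]mulmx1 -CD mulmxA -/w w0 mul0mx.
have h_inj : injective h.
  move=> u v uv; apply/eqP; rewrite -subr_eq0; apply/eqP/h0.
  by rewrite -[h]/(hl : _ -> _) linearB /= uv subrr.
have h_surj v : exists u, h u = v.
  have [u <-] := s_surj v.
  have /sub_addsmxP[[a b] /= ->] : (u <= A + A^C)%MS.
    exact/submx_full/addsmx_compl_full.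
  rewrite linearD sA add0r.
  have /submxP[D ->] : (b *m A^C <= C)%MS by rewrite eq_row_base submxMl.
  by exists D.
have [g gK] := choice h_surj.
have Kg : cancel h g by move=> u; apply: h_inj; rewrite gK.
have gL : linear g by exact: (@can2_linear _ _ _ hl _ Kg gK).
exists (\rank (A^C)%MS).
pose gl : {linear _ -> _} := HB.pack g (GRing.isLinear.Build _ _ _ _ g gL).
by exists gl, h.
Qed.

Lemma fin_dim_span (F : fieldType) (V : lmodType F) (t : seq V) :
  (forall v, exists u : 'rV[F]_(size t), v = \sum_i u 0 i *: t`_i) ->
  fin_dim V.
Proof.
move=> tV; pose s (u : 'rV[F]_(size t)) := \sum_i u 0 i *: t`_i.
have sL : linear s.
  move=> a u v; rewrite scaler_sumr -big_split; apply: eq_bigr => i _ /=.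
  by rewrite !mxE scalerDl scalerA.
pose sl : {linear _ -> _} := HB.pack s (GRing.isLinear.Build _ _ _ _ s sL).
by apply: (@fin_dim_linear_image _ _ _ sl) => v; have [u ->] := tV v; exists u.
Qed.

Lemma mem_lincomb (F : fieldType) (V : lmodType F) (t : seq V) w :
  w \in t -> exists u : 'rV[F]_(size t), w = \sum_i u 0 i *: t`_i.
Proof.
move=> w_t; have lt_w : (index w t < size t)%N by rewrite index_mem.
exists (delta_mx 0 (Ordinal lt_w)).
rewrite (bigD1 (Ordinal lt_w))//= mxE !eqxx scale1r nth_index// big1 ?addr0//.
by move=> i /negPf ni; rewrite mxE ni andbF scale0r.
Qed.

Lemma fin_dim_finite (F : finFieldType) (V : lmodType F) :
  fin_dim V <-> exists s : seq V, forall v, v \in s.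
Proof.
split=> [[d [f [g fK gK]]]|[s sV]].
  by exists [seq g u | u : 'rV[F]_d] => v; rewrite -[v]fK fintype.image_f.
by apply: (@fin_dim_span _ _ s) => v; exact: mem_lincomb.
Qed.

Lemma fin_dim_surj (F : finFieldType) (V W : lmodType F) (f : V -> W) :
  (forall w, exists v, f v = w) -> fin_dim V -> fin_dim W.
Proof.
move=> f_surj /fin_dim_finite[s sV]; apply/fin_dim_finite.
by exists (map f s) => w; have [v <-] := f_surj w; exact: map_f.
Qed.

Lemma fin_dim_inj (F : finFieldType) (V W : lmodType F) (f : V -> W) :
  injective f -> fin_dim W -> fin_dim V.
Proof.
move=> f_inj; pose g w := xget 0 [set v | f v = w]%classic.
apply: (@fin_dim_surj _ _ _ g) => v; exists (f v).
by apply: xget_unique => // u /f_inj.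
Qed.

Lemma fin_dimE (F : fieldType) (V : lmodType F) :
  fin_dim V -> has_dim V (dimension V).
Proof. by move=> [d Vd]; rewrite (dimensionP Vd). Qed.

Lemma dimension_inj_le (F : fieldType) (V W : lmodType F) (h : V -> W) :
  linear h -> injective h -> fin_dim V -> fin_dim W ->
  (dimension V <= dimension W)%N.
Proof.
move=> hL h_inj /fin_dimE[f [f' fK f'K]] /fin_dimE[g [g' gK _]].
have f'L : linear f' by apply: can2_linear fK f'K.
pose k v := g (h (f' v)).
have kL : linear k by move=> a u v; rewrite /k f'L hL linearP.
pose kl : {linear _ -> _} := HB.pack k (GRing.isLinear.Build _ _ _ _ k kL).
suff /eqP <- : row_free (lin1_mx kl) by exact: rank_leq_col.
apply: inj_row_free => v; rewrite mul_rV_lin1 /= => kv0.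
apply: (can_inj f'K); apply: h_inj; apply: (can_inj gK).
by rewrite -/(k v) kv0 -(linear0 kl).
Qed.

Lemma dimension_bij (F : fieldType) (V W : lmodType F) (h : V -> W) :
  linear h -> bijective h -> fin_dim V -> fin_dim W ->
  dimension V = dimension W.
Proof.
move=> hL [g hK gK] fV fW.
pose hl : {linear _ -> _} := HB.pack h (GRing.isLinear.Build _ _ _ _ h hL).
have gL : linear g by exact: (@can2_linear _ _ _ hl _ hK gK).
apply/eqP; rewrite eqn_leq (dimension_inj_le hL (can_inj hK))//.
exact: (dimension_inj_le gL (can_inj gK)).
Qed.

End FiniteDimension.

(** * Maps on the graded Lie algebra *)

Section LowerCentralSeries.
Variables (p : nat) (p_pr : prime p).
Local Notation cl G n x := (vcls p_pr (gr_sec p G n) x).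

Lemma gr_clP (G : groupType) n x y : x \in lcs G p n -> y \in lcs G p n ->
  cl G n x = cl G n y <-> exists2 u, u \in lcs G p n.+1 & y = (x * u)%g.
Proof.
move=> Hx Hy; split=> [/vclsP E|[u Hu ->]].
  by exists (x^-1 * y)%g; rewrite ?mulVKg//; exact: E.
have Hu' := lcs_le Hu.
by rewrite vclsM// [X in _ + X]vcls_bot ?addr0.
Qed.

(** For [x] in gamma_n and [u] in gamma_(n+1), the p-th power of [x * u] is
    [x ^+ p * u ^+ p] modulo commutators of [u] with powers of [x], and both
    these commutators and [u ^+ p] lie in gamma_(n+2). So the p-th power is a
    well-defined map from gr_n to gr_(n+1), although it need not be additive
    (for p = 2 and n = 1, the bracket measures the defect). *)
Lemma gr_expg_eq (G : groupType) n x y : x \in lcs G p n -> y \in lcs G p n ->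
  cl G n x = cl G n y -> cl G n.+1 (x ^+ p)%g = cl G n.+1 (y ^+ p)%g.
Proof.
move=> Hx Hy /gr_clP -/(_ Hx Hy)[u Hu ->].
have gN := @lcs_group G p n.+2.
have expE k : exists2 v, v \in lcs G p n.+2 &
    ((x * u) ^+ k = x ^+ k * u ^+ k * v)%g.
  elim: k => [|k [v Hv IH]]; first by exists 1%g; rewrite ?gr1// !mulg1.
  exists ([~ u, x ^+ k] ^ (u ^+ k) * v)%g.
    by rewrite grM// lcsJ// lcsRl.
  by rewrite expgS IH !expgS -!mulgA !mulVKg.
have [v Hv ->] := expE p.
have Hw : (u ^+ p * v)%g \in lcs G p n.+2 by rewrite grM// lcsX.
rewrite -mulgA; apply/gr_clP; [exact: lcsX | | by exists (u ^+ p * v)%g].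
by apply: (grM (@lcs_group G p n.+1)); [exact: lcsX | exact: lcs_le].
Qed.

Lemma gr_mapE (K G : groupType) (f : {multiplicative K -> G}) n x :
  x \in lcs K p n -> gr_map p_pr f n (cl K n x) = cl G n (f x).
Proof.
by move=> Hx; apply: vmapE => //; [exact: gmulfM | exact: lcs_morph..].
Qed.

(** gr^p is generated from degree 1 by brackets and p-th powers, both of which
    are natural and depend only on classes; so a morphism acts on gr^p the way
    its action in degree 1 dictates. *)
Lemma gr_eq_from_degree1 (K G : groupType) (f h : {multiplicative K -> G}) :
  (forall x, cl G 1 (f x) = cl G 1 (h x)) ->
  forall n x, x \in lcs K p n.+1 -> cl G n.+1 (f x) = cl G n.+1 (h x).
Proof.
move=> fh1; elim=> [|n IH] x Hx; first exact: fh1.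
have gK := @lcs_group K p n.+2; have gG := @lcs_group G p n.+2.
pose S : {pred K} := fun x =>
  (x \in lcs K p n.+2) && (cl G n.+2 (f x) == cl G n.+2 (h x)).
have SP z : reflect
    (z \in lcs K p n.+2 /\ cl G n.+2 (f z) = cl G n.+2 (h z)) (z \in S).
  by apply: (iffP andP) => [[? /eqP]|[? /eqP]].
have gS : group_closed S.
  split; first by apply/SP; rewrite gr1// !gm1.
  move=> a b /SP[Ha Ea] /SP[Hb Eb]; apply/SP; split; first by rewrite grM ?grV.
  by rewrite !gmulfM !gmV !vclsM ?grV ?lcs_morph// !vclsV ?lcs_morph// Ea Eb.
suff /SP[] : x \in S by [].
move: Hx; rewrite {1}lcsS; apply: join_sub => //.
  apply: powers_sub => // a Ha; apply/SP; split; first exact: lcsX.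
  by rewrite !gmX; apply: gr_expg_eq; rewrite ?lcs_morph// IH.
apply: commutators_sub => // a b _ Hb; apply/SP; split; first exact: lcsR.
(* The class of the commutator is the bracket of the classes. *)
by rewrite !gmR -[n.+2]/(1 + n.+1)%N -!gr_brE ?lcs_morph// fh1 (IH b Hb).
Qed.

(** Degree 1 and degree n+1 are finite sets, and gr_(n+2) is spanned by the
    finitely many brackets and p-th powers that they produce. *)
Lemma gr_fin_dimS (G : groupType) n :
  fin_dim (gr p_pr G 1) -> fin_dim (gr p_pr G n.+1) ->
  fin_dim (gr p_pr G n.+2).
Proof.
move=> /fin_dim_finite[s1 s1P] /fin_dim_finite[s sP].
pose t : seq (gr p_pr G n.+2) :=
  [seq gr_br a b | a <- s1, b <- s] ++ [seq cl G n.+2 (rep b ^+ p)%g | b <- s].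
apply: (@fin_dim_span _ _ t) => v.
have gG := @lcs_group G p n.+2.
pose spanned w := exists u : 'rV['F_p]_(size t), w = \sum_i u 0 i *: t`_i.
have spannedB w1 w2 : spanned w1 -> spanned w2 -> spanned (w1 - w2).
  move=> [u1 ->] [u2 ->]; exists (u1 - u2); rewrite -sumrB.
  by apply: eq_bigr => i _; rewrite !mxE scalerBl.
pose S : {pred G} :=
  fun x => `[< x \in lcs G p n.+2 /\ spanned (cl G n.+2 x) >].
have SP z :
  reflect (z \in lcs G p n.+2 /\ spanned (cl G n.+2 z)) (z \in S).
  exact: asboolP.
have gS : group_closed S.
  split.
    apply/SP; rewrite gr1//; split=> //; exists 0.
    by rewrite vcls1 big1// => i _; rewrite mxE scale0r.
  move=> a b /SP[Ha Ea] /SP[Hb Eb]; apply/SP; split; first by rewrite grM ?grV.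
  by rewrite vclsM ?grV// vclsV//; exact: spannedB.
elim/vquot_ind: v => x Hx; suff /SP[] : x \in S by [].
move: Hx; rewrite /= {1}lcsS; apply: join_sub => //.
  apply: powers_sub => // a Ha; apply/SP; split; first exact: lcsX.
  apply: mem_lincomb; rewrite mem_cat; apply/orP; right.
  apply/mapP; exists (cl G n.+1 a) => //.
  by apply: gr_expg_eq; rewrite ?vclsK//; exact: (@rep_top _ (gr_sec p G n.+1)).
apply: commutators_sub => // a b _ Hb; apply/SP; split; first exact: lcsR.
apply: mem_lincomb; rewrite mem_cat; apply/orP; left.
apply/allpairsP; exists (cl G 1 a, cl G n.+1 b); split=> //=.
by rewrite gr_brE.
Qed.

Lemma gr_fin_dim (G : groupType) n :
  fin_dim (gr p_pr G 1) -> fin_dim (gr p_pr G n.+1).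
Proof. by move=> fG; elim: n => // n; exact: gr_fin_dimS. Qed.

(** Needed both for the identity of [G] and for the projection of [G] onto
    G / G''_p. *)
Lemma fin_dim_gr1 (G G' : groupType) (f : {multiplicative G -> G'}) :
  (forall y, exists x, f x = y) -> b1_finite p_pr G -> fin_dim (gr p_pr G' 1).
Proof.
move=> f_surj; apply: (@fin_dim_surj _ _ _ (vmap (gr_sec p G' 1) f)) => w.
elim/vquot_ind: w => y _; have [x <-] := f_surj y.
exists (vcls p_pr (H1_sec p G) x); apply: vmapE => //; first exact: gmulfM.
by move=> z Hz; apply: (@lcs_morph _ _ f p 2).
Qed.

End LowerCentralSeries.

(** * Images of subgroups *)

Section Images.
Variables (G G' : groupType) (f : {multiplicative G -> G'}).

Definition image_of (H : {pred G}) : {pred G'} :=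
  fun y => `[< exists2 x, x \in H & f x = y >].

Lemma image_ofP (H : {pred G}) y :
  reflect (exists2 x, x \in H & f x = y) (y \in image_of H).
Proof. exact: asboolP. Qed.

Lemma image_group (H : {pred G}) : group_closed H -> group_closed (image_of H).
Proof.
move=> gH; split; first by apply/image_ofP; exists 1%g; rewrite ?gr1 ?gm1.
move=> _ _ /image_ofP[x Hx <-] /image_ofP[y Hy <-]; apply/image_ofP.
by exists (x * y^-1)%g; rewrite ?grM ?grV// gmulfM gmV.
Qed.

Lemma pderived_image p (H : {pred G}) (H' : {pred G'}) :
  {subset H' <= image_of H} ->
  {subset pderived p H' <= image_of (pderived p H)}.
Proof.
have gI : group_closed (image_of (pderived p H)) by exact/image_group/gen_group.
move=> sub; apply: join_sub => //.
  apply: powers_sub => // _ /sub/image_ofP[x Hx <-].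
  by apply/image_ofP; exists (x ^+ p)%g; rewrite ?gmX ?pderivedX.
apply: commutators_sub => // _ _ /sub/image_ofP[x Hx <-]
  /sub/image_ofP[y Hy <-].
by apply/image_ofP; exists [~ x, y]%g; rewrite ?gmR ?pderivedR.
Qed.

End Images.

(** * The Alexander invariant as a module *)

Section AlexanderModule.
Variables (p : nat) (p_pr : prime p) (K G : groupType).
Variable f : {multiplicative K -> G}.

Lemma H1_mapE x :
  H1_map p_pr f (vcls p_pr (H1_sec p K) x) = vcls p_pr (H1_sec p G) (f x).
Proof. by apply: vmapE => //; [exact: gmulfM | exact: pderived1_morph]. Qed.

Lemma Bp_mapE x : x \in pderived1 K p ->
  Bp_map p_pr f (vcls p_pr (B_sec p K) x) = vcls p_pr (B_sec p G) (f x).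
Proof.
move=> Hx; apply: vmapE => //; first exact: gmulfM.
  exact: pderived1_morph.
exact: pderived2_morph.
Qed.

(** Equivariance is checked on the basis elements of the group algebra, where
    it says that [f] commutes with conjugation. *)
Lemma Bp_map_linear :
  linear_for (gamap (H1_map p_pr f) \; *:%R) (Bp_map p_pr f).
Proof.
have BfL : linear (Bp_map p_pr f : Balex p_pr K -> Balex p_pr G).
  apply: vmap_linear => //; first exact: gmulfM.
    exact: pderived1_morph.
  exact: pderived2_morph.
have BfD : {morph Bp_map p_pr f : u v / u + v}.
  by move=> u v; have := BfL 1 u v; rewrite !scale1r.
have Bf0 : Bp_map p_pr f 0 = 0.
  by apply: (@addrI _ (Bp_map p_pr f 0)); rewrite -BfD !addr0.
have Bf_act h (b : Balex p_pr K) :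
    Bp_map p_pr f (Bact h b) = Bact (H1_map p_pr f h) (Bp_map p_pr f b).
  elim/vquot_ind: h => x _; elim/vquot_ind: b => y Hy.
  rewrite BactE// !Bp_mapE ?pderived1J// H1_mapE.
  by rewrite BactE ?pderived1_morph// gmJ gmV.
have scaleUE (G0 : groupType) (k : 'F_p) (h : H1 p_pr G0) (b : Bp p_pr G0) :
    (<< k *g h >> : grpalg 'F_p (H1 p_pr G0)) *: b
    = (k *: Bact h (b : Balex p_pr G0) : Balex p_pr G0).
  exact: (@gascaleU _ _ (Balex p_pr G0) (@Bact p p_pr G0)).
move=> a u v; rewrite BfD; congr (_ + _) => /=.
elim/ga_ind: a => [|g1 g2 IH1 IH2|k h].
- by rewrite gamap0 !scale0r Bf0.
- by rewrite gamapD !scalerDl BfD IH1 IH2.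
rewrite gamapU !scaleUE -Bf_act.
have := BfL k (Bact h u) 0; rewrite !addr0 => ->.
by rewrite Bf0 addr0.
Qed.

End AlexanderModule.

(** * Injections that identify the first p-derived subgroups *)

(** This is the form in which p-exactness over an elementary abelian quotient is
    used: it speaks of [f] alone, and it passes from [f] to [metab_map p f]. The
    image of [f] is then normal, because it contains the commutators
    [[f x, g]]. *)
Definition same_pderived1 (p : nat) (K G : groupType)
    (f : {multiplicative K -> G}) :=
  injective f /\ {subset pderived1 G p <= image_of f (pderived1 K p)}.

Section MetabProjection.
Variables (p : nat) (G : groupType).

Definition metab_proj (x : G) : metab p G := cls (metab_sec p G) x.

Lemma metab_projM : {morph metab_proj : x y / (x * y)%g}.
Proof. by move=> x y; exact: clsM. Qed.
HB.instance Definition _ :=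
  isMultiplicative.Build G (metab p G) metab_proj metab_projM.

Lemma metab_proj_surj a : exists x, metab_proj x = a.
Proof. by exists (rep a); exact: repK. Qed.

Lemma pderived1_metab :
  {subset pderived1 (metab p G) p <= image_of metab_proj (pderived1 G p)}.
Proof.
apply: pderived_image => a _; apply/image_ofP.
by have [x <-] := metab_proj_surj a; exists x.
Qed.

End MetabProjection.

Arguments metab_proj p {G} x.

Section SamePderived1.
Variables (p : nat) (p_pr : prime p) (K G : groupType).
Variables (f : {multiplicative K -> G}) (fD : same_pderived1 p f).
Local Notation cl G n x := (vcls p_pr (gr_sec p G n) x).

Lemma inj_image_of (H : {pred K}) x : (f x \in image_of f H) = (x \in H).
Proof.
have [f_inj _] := fD.
by apply/image_ofP/idP => [[y Hy /f_inj <-]//|Hx]; exists x.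
Qed.

Lemma pderived2_image : {subset pderived2 G p <= image_of f (pderived2 K p)}.
Proof. by apply: pderived_image; case: fD. Qed.

(** Conjugation by [g] preserves the image of [f] and moves [f x] by
    [[f x, g]], an element of G'_p, so it is trivial on K / K'_p. *)
Lemma conj_same_pderived1 g : exists h : {multiplicative K -> K},
  (forall x, f (h x) = (f x ^ g)%g) /\ (forall x, cl K 1 (h x) = cl K 1 x).
Proof.
have [f_inj fD1] := fD.
have conjE x : exists2 u, u \in pderived1 K p & f (x * u)%g = (f x ^ g)%g.
  have : [~ f x, g]%g \in pderived1 G p by exact: pderivedR.
  move=> /fD1/image_ofP[u Hu fu]; exists u => //.
  by rewrite gmulfM fu commgEl mulVKg.
have /choice[h hE] : forall x, exists y, f y = (f x ^ g)%g.
  by move=> x; have [u _ <-] := conjE x; exists (x * u)%g.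
have hM : {morph h : x y / (x * y)%g}.
  by move=> x y; apply: f_inj; rewrite gmulfM !hE gmulfM conjMg.
pose hm : {multiplicative K -> K} :=
  HB.pack h (isMultiplicative.Build K K h hM).
exists hm; split=> //= x.
have [u Hu] := conjE x; rewrite -hE => /f_inj <-.
by apply/esym/gr_clP => //; exists u.
Qed.

(** Conjugation by [g] is trivial on gr^p(K), not only on gr^p_1(K); this is
    the step from commutators with K to commutators with all of G. *)
Lemma commg_lcs_image g n x : x \in lcs K p n.+1 ->
  [~ g, f x]%g \in image_of f (lcs K p n.+2).
Proof.
move=> Hx; have [h [hE h1]] := conj_same_pderived1 g.
have := @gr_eq_from_degree1 p p_pr K K h idfun h1 n x Hx.
move=> /gr_clP-/(_ (lcs_morph h Hx) Hx)[u Hu] /= Ex.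
have -> : [~ g, f x]%g = f u.
  by rewrite commgEr conjVg -hE -gmV -gmulfM [X in (_ * X)%g]Ex mulKg.
by rewrite inj_image_of.
Qed.

(** The base case n = 2 is the hypothesis on [f]; degree 1 has to be left out,
    since [f] need not be surjective. *)
Lemma lcs_image n : (1 < n)%N -> {subset lcs G p n <= image_of f (lcs K p n)}.
Proof.
case: n => [|[|n]]// _; elim: n => [|n IH]; first by case: fD.
have gI : group_closed (image_of f (lcs K p n.+3)).
  exact/image_group/lcs_group.
rewrite lcsS; apply: join_sub => //.
  apply: powers_sub => // _ /IH/image_ofP[x Hx <-].
  by rewrite -gmX inj_image_of lcsX.
apply: commutators_sub => // g _ _ /IH/image_ofP[x Hx <-].
exact: commg_lcs_image.
Qed.

(** Degree 1 is included: gamma_2(G) pulls back to gamma_2(K). *)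
Lemma gr_map_inj n : (0 < n)%N -> injective (gr_map p_pr f n).
Proof.
have [f_inj _] := fD.
move=> n_gt0; elim/vquot_ind=> x Hx; elim/vquot_ind=> y Hy.
rewrite !gr_mapE// => /vclsP-/(_ (lcs_morph f Hx) (lcs_morph f Hy)).
rewrite -gmV -gmulfM => /lcs_image/image_ofP[//|u Hu /f_inj uE].
by apply/vclsP; rewrite //= -uE.
Qed.

Lemma gr_map_surj n : (1 < n)%N -> forall w, exists v, gr_map p_pr f n v = w.
Proof.
move=> n_gt1; elim/vquot_ind=> _ /(lcs_image n_gt1)/image_ofP[x Hx <-].
by exists (cl K n x); rewrite gr_mapE.
Qed.

Lemma gr_map_bij n : (1 < n)%N -> bijective (gr_map p_pr f n).
Proof.
move=> n_gt1; have [g gK] := choice (gr_map_surj n_gt1).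
by exists g => // v; apply: (gr_map_inj (ltnW n_gt1)); rewrite gK.
Qed.

Lemma gr_map_iso : gl_iso_ge 2 (gr_map p_pr f).
Proof.
split=> [n _|n|m n x y _ _]; [exact: gr_map_linear | exact: gr_map_bij|].
exact: gr_map_br.
Qed.

Lemma dimension_gr_le n : (0 < n)%N -> fin_dim (gr p_pr G n) ->
  fin_dim (gr p_pr K n) /\
  (dimension (gr p_pr K n) <= dimension (gr p_pr G n))%N.
Proof.
move=> n_gt0 fG.
have fK : fin_dim (gr p_pr K n) by exact: fin_dim_inj (gr_map_inj n_gt0) fG.
split=> //; apply: (@dimension_inj_le _ _ _ (gr_map p_pr f n)) => //.
  exact: gr_map_linear.
exact: gr_map_inj.
Qed.

Lemma dimension_gr_eq n : (1 < n)%N -> fin_dim (gr p_pr G n) ->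
  dimension (gr p_pr K n) = dimension (gr p_pr G n).
Proof.
move=> n_gt1 fG; have [fK _] := dimension_gr_le (ltnW n_gt1) fG.
apply: (@dimension_bij _ _ _ (gr_map p_pr f n)) => //.
  exact: gr_map_linear.
exact: gr_map_bij.
Qed.

Lemma Bp_map_bij : bijective (Bp_map p_pr f).
Proof.
have [f_inj fD1] := fD.
have Bf_inj : injective (Bp_map p_pr f).
  elim/vquot_ind=> x Hx; elim/vquot_ind=> y Hy; rewrite !Bp_mapE//.
  move=> /vclsP-/(_ (pderived1_morph f Hx) (pderived1_morph f Hy)).
  rewrite -gmV -gmulfM => /pderived2_image/image_ofP[u Hu /f_inj uE].
  by apply/vclsP; rewrite //= -uE.
have Bf_surj w : exists v, Bp_map p_pr f v = w.
  elim/vquot_ind: w => _ /fD1/image_ofP[x Hx <-].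
  by exists (vcls p_pr (B_sec p K) x); rewrite Bp_mapE.
have [g gK] := choice Bf_surj.
by exists g => // v; apply: Bf_inj; rewrite gK.
Qed.

Lemma metab_same_pderived1 : same_pderived1 p (metab_map p f).
Proof.
have [f_inj fD1] := fD.
have mE x : metab_map p f (metab_proj p x) = metab_proj p (f x).
  by apply: smapE => //; [exact: gmulfM | exact: pderived2_morph].
split=> [a b|c /pderived1_metab/image_ofP[_ /fD1/image_ofP[y Hy <-] <-]].
  have [[x <-] [y <-]] := (metab_proj_surj a, metab_proj_surj b).
  rewrite /= !mE => /clsP-/(_ isT isT).
  rewrite -gmV -gmulfM => /pderived2_image/image_ofP[u Hu /f_inj uE].
  by apply/clsP; rewrite //= -uE.
apply/image_ofP; exists (metab_proj p y); first exact: pderived1_morph.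
exact: mE.
Qed.

End SamePderived1.

(** * The theorem *)

(** G'_p maps to Q'_p = 1, so it lies in the image of [iota]; injectivity on
    H_1 then brings it back into K'_p. *)
Lemma p_exact_same_pderived1 (p : nat) (p_pr : prime p) (K G Q : groupType)
    (iota : {multiplicative K -> G}) (pr : {multiplicative G -> Q}) :
  p_exact iota pr p_pr -> elementary_abelian Q p -> same_pderived1 p iota.
Proof.
move=> [[i_inj ker_pr _] [H1_inj _ _]] [QC Qp]; split=> // x Hx.
have : pr x \in pderived1 Q p by exact: pderived1_morph.
have trivQ : group_closed (pred1 (1 : Q)%g).
  by split=> [|y z]; rewrite !inE// => /eqP-> /eqP->; rewrite invg1 mulg1.
move=> prx; have /eqP/ker_pr[y Ey] : pr x \in pred1 (1 : Q)%g.
  move: prx; apply: join_sub => //.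
    by apply: powers_sub => // z _; rewrite inE Qp.
  apply: commutators_sub => // u v _ _.
  by rewrite inE commgEl /conjg (QC u v) mulKg mulVg.
apply/image_ofP; exists y => //.
have : vcls p_pr (H1_sec p K) y = 0.
  apply: H1_inj; rewrite -vcls1 !H1_mapE gm1 vcls1; apply: vcls_bot.
  by rewrite Ey.
by move/eqP; rewrite vcls_eq0.
Qed.

Unset Implicit Arguments.

Theorem theorem1p4 (p : nat) (p_pr : prime p) (K G Q : groupType)
    (iota : {multiplicative K -> G}) (pr : {multiplicative G -> Q}) :
  p_exact iota pr p_pr -> elementary_abelian Q p ->
  [/\ linear_for (gamap (H1_map p_pr iota) \; *:%R) (Bp_map p_pr iota) /\
      bijective (Bp_map p_pr iota),
      b1_finite p_pr G -> forall n, (1 <= n)%N ->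
        [/\ fin_dim (gr p_pr (metab p K) n), fin_dim (gr p_pr (metab p G) n)
          & (theta p_pr K n <= theta p_pr G n)%N]
    & is_split pr ->
      [/\ gl_iso_ge 2 (gr_map p_pr iota),
          gl_iso_ge 2 (gr_map p_pr (metab_map p iota))
        & b1_finite p_pr G -> forall n, (2 <= n)%N ->
          [/\ fin_dim (gr p_pr K n), fin_dim (gr p_pr G n),
              fin_dim (gr p_pr (metab p K) n), fin_dim (gr p_pr (metab p G) n)
            & phi p_pr K n = phi p_pr G n /\ theta p_pr K n = theta p_pr G n]]].
Proof.
move=> exG abQ; have iD := p_exact_same_pderived1 exG abQ.
have mD := metab_same_pderived1 iD.
have finG : b1_finite p_pr G -> forall n, (1 <= n)%N ->
    fin_dim (gr p_pr G n) /\ fin_dim (gr p_pr (metab p G) n).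
  move=> fG [|n]// _; split; apply: gr_fin_dim.
    by apply: (@fin_dim_gr1 p p_pr G G idfun) => // y; exists y.
  apply: (@fin_dim_gr1 p p_pr G (metab p G) (metab_proj p)) fG => //.
  exact: metab_proj_surj.
split; first by split; [exact: Bp_map_linear | exact: Bp_map_bij].
  move=> fG n n_gt0; have [_ fM] := finG fG n n_gt0.
  by have [] := dimension_gr_le mD n_gt0 fM.
move=> _; split; [exact: gr_map_iso | exact: gr_map_iso|] => fG n n_gt1.
have n_gt0 := ltnW n_gt1; have [fG' fM] := finG fG n n_gt0.
have [fK _] := dimension_gr_le iD n_gt0 fG'.
have [fMK _] := dimension_gr_le mD n_gt0 fM.
split=> //; split; first exact: (dimension_gr_eq iD).
exact: (dimension_gr_eq mD).
Qed.
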